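(* Let $q$ be a prime power, and let $n, k, m$ be integers with $n/2 < k < n$ and $1 \leq m \leq q^k$. Let $S \subseteq \mathbb{F}_q^n$. Let $L$ be a set of $k$-flats in $\mathbb{F}_q^n$ that each contain at least $m$ points of $S$, with $|L| = \binom{n}{k}_q$. Then $$|S| \geq \left(1 - q^{n-2k} - \sqrt{q^{n-k} m^{-1}}\right) m\, q^{n-k}.$$ In particular, the same lower bound holds for $K(q,n,k,m)$, i.e. $K(q,n,k,m) \geq \left(1 - q^{n-2k} - \sqrt{q^{n-k} m^{-1}}\right) m\, q^{n-k}$.
   Context: $\mathbb{F}_q$ is the finite field with $q$ elements. A $k$-flat in $\mathbb{F}_q^n$ is a translate of a $k$-dimensional linear subspace. $\binom{n}{k}_q = \frac{(1-q^n)(1-q^{n-1})\cdots(1-q^{n-k+1})}{(1-q)(1-q^2)\cdots(1-q^k)}$ is the $q$-binomial coefficient, equal to the number of $k$-dimensional linear subspaces of $\mathbb{F}_q^n$. The flats in $L$ are not assumed to have different directions. For integers $1 \leq k < n$ and $m \geq 1$, a subset $S \subseteq \mathbb{F}_q^n$ is a $(k,m)$-Furstenberg set if for each $k$-dimensional linear subspace $W$ of $\mathbb{F}_q^n$ there is a translate of $W$ that intersects $S$ in at least $m$ points. For $1 \leq k < n$ and $m \leq q^k$, $K(q,n,k,m)$ denotes the least $t$ such that there exists a $(k,m)$-Furstenberg set in $\mathbb{F}_q^n$ of cardinality $t$. *)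

(* Defs.v *)
From HB Require Import structures.
From mathcomp Require Import all_boot all_order all_algebra.

Set Implicit Arguments.
Unset Strict Implicit.
Unset Printing Implicit Defensive.

Import Order.TTheory GRing.Theory Num.Theory.
Local Open Scope ring_scope.

(* Subspaces of F^n are encoded by canonical matrices over the finite field F,
   so there are finitely many of them. *)
HB.instance Definition _ (F : finFieldType) (n : nat) :=
  CanIsCountable (@VectorInternalTheory.vs2mxK F 'rV[F]_n).
HB.instance Definition _ (F : finFieldType) (n : nat) : isFinite {vspace 'rV[F]_n} :=
  CanIsFinite (@VectorInternalTheory.vs2mxK F 'rV[F]_n).

Definition qbinom (R : fieldType) (q : R) (n k : nat) : R :=
  (\prod_(0 <= i < k) (1 - q ^+ (n - i))) / (\prod_(1 <= j < k.+1) (1 - q ^+ j)).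

Section Flats.
Variables (F : finFieldType) (n : nat).
Implicit Types (W : {vspace 'rV[F]_n}) (v : 'rV[F]_n) (A S : {set 'rV[F]_n}).

Definition translate v W : {set 'rV[F]_n} := [set v + w | w in W].

Definition is_flat (k : nat) A : bool :=
  [exists W : {vspace 'rV[F]_n},
    (\dim W == k) && [exists v : 'rV[F]_n, A == translate v W]].

Definition furstenberg_set (k m : nat) S : bool :=
  [forall W : {vspace 'rV[F]_n},
    (\dim W == k) ==> [exists v : 'rV[F]_n, (m <= #|S :&: translate v W|)%N]].

(* The value is meaningful only when m <= #|F| ^ k; then the whole space is a
   (k, m)-Furstenberg set (furstenberg_setT), and furstenberg_minP below
   characterizes the value. *)
Definition furstenberg_min (k m : nat) : nat :=
  #|[arg min_(S < [set: 'rV[F]_n] | furstenberg_set k m S) #|S|]|.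

Lemma card_translate v W : #|translate v W| = (#|F| ^ \dim W)%N.
Proof.
rewrite card_imset; last exact: addrI.
pose f (u : 'rV[F]_(\dim W)) : 'rV[F]_n := \sum_i u 0 i *: (vbasis W)`_i.
have inj_f : injective f.
  move=> u1 u2 E; apply/rowP => i; have fW := basis_free (vbasisP W).
  by rewrite -(coord_sum_free (fun j => u1 0 j) i fW) [X in coord _ _ X]E coord_sum_free.
have -> : #|W| = #|f @: [set: 'rV[F]_(\dim W)]|.
  apply: eq_card => w; apply/idP/imsetP => [wW | [u _ ->]].
    exists (\row_i coord (vbasis W) i w) => //.
    rewrite {1}(coord_vbasis wW) /f.
    by apply: eq_bigr => i _; rewrite mxE.
  apply: rpred_sum => i _; apply: rpredZ.
  by rewrite vbasis_mem // mem_nth // size_tuple.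
by rewrite card_imset // cardsT card_mx mul1n.
Qed.

Lemma furstenberg_setT (k m : nat) :
  (m <= #|F| ^ k)%N -> furstenberg_set k m [set: 'rV[F]_n].
Proof.
move=> hm; apply/forallP => W; apply/implyP => /eqP dW; apply/existsP.
by exists 0; rewrite setTI card_translate dW.
Qed.

Lemma furstenberg_minP (k m : nat) : (m <= #|F| ^ k)%N ->
  (exists S, furstenberg_set k m S /\ #|S| = furstenberg_min k m) /\
  (forall S, furstenberg_set k m S -> (furstenberg_min k m <= #|S|)%N).
Proof.
move=> /furstenberg_setT hT; rewrite /furstenberg_min.
case: arg_minnP => // S0 S0P S0min; split=> //.
by exists S0.
Qed.

End Flats.

Arguments furstenberg_min : clear implicits.

(* Main.v *)
Require Import Defs.
From mathcomp Require Import all_boot all_order all_algebra.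
From mathcomp Require Import finfield zify ring lra.

Import Order.TTheory GRing.Theory Num.Theory.
Local Open Scope ring_scope.

(** The bound follows from a second moment estimate over all [k]-flats.  Write
    [s] for the cardinality of [S], [r = q ^ (n - k)], and [G] for the number of
    [k]-dimensional subspaces.  A flat meets [S] in [s / r] points on average.
    A nonzero vector lies in at most [G / r] subspaces of dimension [k]
    ([card_subspaces_over1]), so the ordered pairs of points of [S] which lie on
    a common flat number at most [s * G + s ^ 2 * G / r], counted with
    multiplicity; hence the squared deviations of [#|A :&: S|] from [s / r],
    summed over all [k]-flats [A], add up to at most [s * G]
    ([second_moment_flats]).

    If [s / r <= m], each of the [G] flats of [L] contributes at least
    [(m - s / r) ^ 2], so [(m - s / r) ^ 2 <= s <= m * r], that is
    [m - s / r <= m * sqrt (r / m)].  This is the announced inequality, even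
    without the term [q ^ (n - 2 k)].  If [m < s / r], there is nothing to prove.

    Both [G = qbinom q n k] and the bound on subspaces through a vector come from
    counting, inside a subspace, the tuples which extend a given free family to a
    longer free family ([card_free_extension]): this counts the subspaces of
    dimension [k] containing that family ([card_subspaces_over]).  Directions of
    flats play no role, so a [(k, m)]-Furstenberg set is covered by letting [L]
    consist of one rich translate of each [k]-dimensional subspace. *)

(** * Counting subspaces through a free family *)

Section SubspaceCounting.
Variables (F : finFieldType) (n : nat).
Local Notation V := 'rV[F]_n.
Local Notation q := #|F|.
Implicit Types (U W : {vspace V}) (v w : V) (X : seq V) (A S : {set V}).

Lemma mem_translate v W w : (w \in translate v W) = (w - v \in W).
Proof.
apply/imsetP/idP => [[u uW ->]|wW]; first by rewrite addrC addKr.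
by exists (w - v); rewrite // addrC subrK.
Qed.

Lemma card_vspaceE W : #|W| = (q ^ \dim W)%N.
Proof. by rewrite -(card_translate 0 W) card_imset //; apply: addrI. Qed.

Lemma card_vspaceD U W : (U <= W)%VS ->
  #|[set w in W | w \notin U]| = (q ^ \dim W - q ^ \dim U)%N.
Proof.
move=> sUW; have := cardsID [set w in U] [set w in W].
have -> : [set w in W] :&: [set w in U] = [set w in U].
  by apply/setIidPr/subsetP => w; rewrite !inE => /(subvP sUW).
have <- : [set w in W | w \notin U] = [set w in W] :\: [set w in U].
  by apply/setP => w; rewrite !inE andbC.
by rewrite (cardsE (mem U)) (cardsE (mem W)) !card_vspaceE => <-; rewrite addKn.
Qed.

(** Each new vector has to avoid the span of those already chosen, whose
    dimension is known by freeness. *)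
Lemma card_free_extension W X k : free X -> (<<X>> <= W)%VS ->
  #|[set Y : k.-tuple V | free (Y ++ X) && (<<Y>> <= W)%VS]|
    = (\prod_(i < k) (q ^ \dim W - q ^ (size X + i)))%N.
Proof.
move=> fX sXW; elim: k => [|k IHk].
  rewrite big_ord0 (eq_card (B := [set: 0.-tuple V])) ?cardsT ?card_tuple //.
  by move=> Y; rewrite tuple0 !inE /= fX span_nil sub0v.
rewrite big_ord_recr /= -IHk -[RHS]sum_nat_const -[LHS]sum1_card.
(* A tuple of length [k + 1] is a tuple of length [k], chosen first, with one
   more vector at its head. *)
pose h (p : k.-tuple V * V) := [tuple of p.2 :: p.1].
rewrite (reindex h) /=; last first.
  exists (fun Y : k.+1.-tuple V => ([tuple of behead Y], thead Y)) => [[Y x]|Y] _.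
    by congr pair; apply: val_inj.
  by rewrite /h /= [RHS]tuple_eta.
pose E := [set Y : k.-tuple V | free (Y ++ X) && (<<Y>> <= W)%VS].
rewrite (eq_bigl (fun p : k.-tuple V * V =>
    (p.1 \in E) && (p.2 \in [set w in W | w \notin <<p.1 ++ X>>%VS]))); last first.
  move=> [Y x]; rewrite !inE /= free_cons span_cons subv_add -memvE.
  by case: (x \in W); case: (x \in _); case: (free _); rewrite /= ?andbT ?andbF.
rewrite -(pair_big_dep (mem E) (fun Y x => x \in [set w in W | w \notin <<Y ++ X>>%VS])
   (fun _ _ => 1%N)) /=.
apply: eq_bigr => Y; rewrite inE => /andP[fYX sYW].
rewrite sum1_card card_vspaceD; last by rewrite span_cat subv_add sYW.
by rewrite (eqP (fYX : free _)) size_cat size_tuple addnC.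
Qed.

(** The [k]-dimensional subspaces which contain all vectors of [X]; for
    [X = [::]], all [k]-dimensional subspaces. *)
Definition subspaces_over k X := [set W | (\dim W == k) && (<<X>> <= W)%VS].

(** Double counting of the tuples [Y] such that [Y ++ X] is free of size [k]:
    each spans, with [X], exactly one [k]-dimensional subspace. *)
Lemma card_subspaces_over k X : free X -> (size X <= k)%N ->
  (#|subspaces_over k X| * \prod_(i < k - size X) (q ^ k - q ^ (size X + i))
    = \prod_(i < k - size X) (q ^ n - q ^ (size X + i)))%N.
Proof.
move=> fX leXk.
have := card_free_extension fullv X (k - size X) fX (subvf _).
rewrite dimvf /dim /= mul1n => <-; rewrite -sum_nat_const -[RHS]sum1_card.
rewrite [RHS](partition_big (fun Y : _.-tuple V => <<Y ++ X>>%VS)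
   (mem (subspaces_over k X))) /=; last first.
  move=> Y; rewrite !inE subvf andbT => fYX.
  by rewrite (eqP (fYX : free _)) size_cat size_tuple subnK // eqxx span_cat addvSr.
apply: eq_bigr => W; rewrite inE => /andP[/eqP dW sXW].
have := card_free_extension W X (k - size X) fX sXW.
rewrite dW => <-; rewrite sum1_card; apply: eq_card => Y.
rewrite [RHS]unfold_in !inE subvf andbT; case fYX: (free _) => //=.
rewrite eqEdim span_cat subv_add sXW andbT dW -span_cat.
by rewrite [\dim <<_>>](eqP fYX) size_cat size_tuple subnK // leqnn andbT.
Qed.

Lemma card_subspaces_gt0 k : (k <= n)%N -> (0 < #|subspaces_over k [::]|)%N.
Proof.
move=> lekn; have := card_subspaces_over k [::] (nil_free _) (leq0n _).
rewrite subn0; case: #|subspaces_over k [::]| => // /esym/eqP.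
rewrite mul0n; apply: contraLR => _; rewrite -lt0n; apply: prodn_gt0 => i.
by rewrite subn_gt0 ltn_exp2l ?finNzRing_gt1 // (leq_trans (ltn_ord i)).
Qed.

(** In fact [#|subspaces_over k [:: v]| * (q ^ n - 1)] equals
    [#|subspaces_over k [::]| * (q ^ k - 1)]. *)
Lemma card_subspaces_over1 k v : (0 < k <= n)%N -> v != 0 ->
  (#|subspaces_over k [:: v]| * q ^ n <= #|subspaces_over k [::]| * q ^ k)%N.
Proof.
case: k => // k /= lekn v0.
have q_gt1 : (1 < q)%N := finNzRing_gt1 F.
have sub : (#|subspaces_over k.+1 [:: v]| <= #|subspaces_over k.+1 [::]|)%N.
  by apply/subset_leq_card/subsetP => W; rewrite !inE span_nil sub0v andbT => /andP[].
have := card_subspaces_over k.+1 [:: v]; rewrite seq1_free v0 /= subSS subn0.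
have := card_subspaces_over k.+1 [::] (nil_free _) (leq0n _).
rewrite subn0 !big_ord_recl /=.
move: sub; set N := #|_|; set G := #|_|; set P := (\prod_i _)%N.
set P' := (\prod_i _)%N => leNG GP /(_ isT isT).
rewrite -[X in (_ * X)%N]/P -[RHS]/P' => NP.
have P_gt0 : (0 < P)%N.
  apply: prodn_gt0 => i; rewrite subn_gt0 ltn_exp2l //.
  exact: ltn_ord.
have /eqP : (P * (N * (q ^ n - 1)) = P * (G * (q ^ k.+1 - 1)))%N.
  move: GP; rewrite -NP !expn0.
  by move: (q ^ n - 1)%N (q ^ k.+1 - 1)%N => a b; lia.
rewrite eqn_pmul2l // !mulnBr !muln1 => /eqP.
have : (N <= N * q ^ n)%N by rewrite leq_pmulr // expn_gt0 ltnW.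
have : (G <= G * q ^ k.+1)%N by rewrite leq_pmulr // expn_gt0 ltnW.
by move: (N * q ^ n)%N (G * q ^ k.+1)%N => a b; lia.
Qed.

End SubspaceCounting.

Arguments subspaces_over {F n} k X.

(** * The q-binomial coefficient *)

Section QBinomial.
Variables (R : numFieldType) (q : nat) (q_gt1 : (1 < q)%N).
Local Notation Q := (q%:R : R).

Lemma prod_subX n k : (k <= n)%N ->
  (\prod_(i < k) (q ^ n - q ^ i))%N%:R
    = \prod_(i < k) (- Q ^+ i) * \prod_(0 <= i < k) (1 - Q ^+ (n - i)).
Proof.
move=> lekn; rewrite big_mkord natr_prod -big_split /=; apply: eq_bigr => i _.
have lein : (i <= n)%N := ltnW (leq_trans (ltn_ord i) lekn).
rewrite natrB ?leq_exp2l // !natrX mulrBr mulr1 mulNr -exprD subnKC //.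
by rewrite opprK addrC.
Qed.

(** A natural number satisfying the cleared-denominator identity of
    [card_subspaces_over] is the q-binomial coefficient. *)
Lemma qbinomP G n k : (k <= n)%N ->
  (G * \prod_(i < k) (q ^ k - q ^ i) = \prod_(i < k) (q ^ n - q ^ i))%N ->
  G%:R = qbinom Q n k.
Proof.
move=> lekn /(congr1 (GRing.natmul (1 : R))); rewrite natrM !prod_subX // mulrCA.
move/mulfI => E.
have nzX j : (0 < j)%N -> 1 - Q ^+ j != 0.
  by move=> j0; rewrite subr_eq0 eq_sym -natrX pnatr_eq1 -(expn0 q) eqn_exp2l // -lt0n.
have Erev : \prod_(0 <= i < k) (1 - Q ^+ (k - i)) = \prod_(1 <= j < k.+1) (1 - Q ^+ j).
  by rewrite big_add1 /= big_nat_rev /= [RHS]big_nat [LHS]big_nat;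
     apply: eq_bigr => i /andP[_ ltik]; congr (1 - Q ^+ _); lia.
rewrite /qbinom -E; last first.
  by apply/prodf_neq0 => i _; rewrite oppr_eq0 expf_neq0 // pnatr_eq0 -lt0n ltnW.
rewrite Erev mulfK // big_add1 big_mkord; apply/prodf_neq0 => i _; exact: nzX.
Qed.

End QBinomial.

(** * Second moment of the intersections with flats *)

Section SecondMoment.
Variables (R : realFieldType) (F : finFieldType) (n : nat).
Local Notation V := 'rV[F]_n.
Local Notation q := #|F|.
Implicit Types (W : {vspace V}) (v w x y : V) (A S : {set V}).

Lemma card_setI_translate S v W :
  #|S :&: translate v W| = (\sum_(x in S) ((x - v)%R \in W))%N.
Proof.
by rewrite -sum1_card; under eq_bigl do rewrite inE; rewrite big_mkcondr;
   apply: eq_bigr => x _; rewrite mem_translate; case: (_ \in W).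
Qed.

Lemma sum_mem_sub W x : (\sum_v ((x - v)%R \in W) = #|W|)%N.
Proof.
rewrite -sum1_card (reindex_inj (inv_inj (subKr x))) /= [RHS]big_mkcond.
by apply: eq_bigr => v _; rewrite subKr; case: (v \in W).
Qed.

Lemma sum_card_translate S W : (\sum_v #|S :&: translate v W| = #|S| * #|W|)%N.
Proof.
under eq_bigr do rewrite card_setI_translate.
by rewrite exchange_big /= -sum_nat_const; apply: eq_bigr => x _; exact: sum_mem_sub.
Qed.

(** Two points lie on a common translate of [W] exactly when their difference is
    in [W], and then they lie on [#|W|] of the [translate v W]. *)
Lemma sum_card_translate_sqr S W :
  (\sum_v #|S :&: translate v W| ^ 2
     = #|W| * \sum_(x in S) \sum_(y in S) ((x - y)%R \in W))%N.
Proof.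
under eq_bigr do rewrite card_setI_translate -mulnn big_distrlr /=.
rewrite exchange_big big_distrr /=; apply: eq_bigr => x _.
rewrite exchange_big big_distrr /=; apply: eq_bigr => y _.
rewrite -(sum_mem_sub W x) big_distrl /=; apply: eq_bigr => v _.
case xvW: (x - v \in W); rewrite ?mul0n // !mul1n; congr nat_of_bool.
have -> : y - v = (x - v) - (x - y) by rewrite opprB [RHS]addrC addrA addrNK.
by rewrite rpredBl.
Qed.

Local Notation subspaces k := (subspaces_over k ([::] : seq V)).

Lemma mem_subspaces k W : (W \in subspaces k) = (\dim W == k).
Proof. by rewrite inE span_nil sub0v andbT. Qed.

(** The first term bounds the diagonal pairs, the second the pairs of distinct
    points. *)
Lemma sum_pairs_subspaces S k : (0 < k <= n)%N ->
  ((\sum_(W in subspaces k) \sum_(x in S) \sum_(y in S) ((x - y)%R \in W)) * q ^ n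
    <= #|S| * (#|subspaces k| * q ^ n) + #|S| * #|S| * (#|subspaces k| * q ^ k))%N.
Proof.
move=> hk; rewrite exchange_big /= -mulnA -mulnDr -sum_nat_const big_distrl /=.
apply: leq_sum => x xS; rewrite exchange_big /= big_distrl /= (bigD1 x) //=.
apply: leq_add.
  apply: leq_mul => //; rewrite -[leqRHS]sum1_card.
  by apply: leq_sum => W _; case: (_ \in W).
rewrite -sum_nat_const [leqRHS](bigD1 x) //=; apply: leq_trans (leq_addl _ _).
apply: leq_sum => y /andP[_ yx].
apply: leq_trans (@card_subspaces_over1 F n k (x - y) hk _); last first.
  by rewrite subr_eq0 eq_sym.
apply: leq_mul => //; rewrite -[leqRHS]sum1_card [leqRHS]big_mkcond [leqLHS]big_mkcond /=.
apply: leq_sum => W _; rewrite !inE span_nil sub0v andbT span_seq1 -memvE.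
by case: (_ == k) => //; case: (_ \in W).
Qed.

(** The sum ranges over the parametrized flats [(W, v)]; each flat occurs
    [q ^ k] times, whence the factor [q ^ k] on the right. *)
Lemma second_moment_flats S k : (0 < k <= n)%N ->
  \sum_(W in subspaces k) \sum_v
     (#|S :&: translate v W|%:R - #|S|%:R / q%:R ^+ (n - k)) ^+ 2
   <= q%:R ^+ k * (#|S|%:R * #|subspaces k|%:R) :> R.
Proof.
move=> hk; have /andP[_ lekn] := hk.
have Q0 : 0 < q%:R :> R by rewrite ltr0n (ltn_trans _ (finNzRing_gt1 F)).
set r : R := _ ^+ (n - k); have r0 : 0 < r by rewrite exprn_gt0.
have Qn : q%:R ^+ n = q%:R ^+ k * r by rewrite -exprD subnKC.
have Qk0 : 0 < q%:R ^+ k :> R by rewrite exprn_gt0.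
set s : R := #|S|%:R; set G : R := #|subspaces k|%:R.
pose P W := (\sum_(x in S) \sum_(y in S) ((x - y)%R \in W))%N.
have inner W : W \in subspaces k ->
   \sum_v (#|S :&: translate v W|%:R - s / r) ^+ 2 = q%:R ^+ k * ((P W)%:R - s ^+ 2 / r).
  rewrite mem_subspaces => /eqP dW.
  have E1 : \sum_v (#|S :&: translate v W|%:R : R) = s * q%:R ^+ k.
    by rewrite -natr_sum sum_card_translate card_vspaceE dW natrM natrX.
  have E2 : \sum_v (#|S :&: translate v W|%:R : R) ^+ 2 = q%:R ^+ k * (P W)%:R.
    under eq_bigr do rewrite -natrX.
    by rewrite -natr_sum sum_card_translate_sqr card_vspaceE dW natrM natrX.
  under eq_bigr do rewrite sqrrB.
  rewrite big_split /= sumrB E2 sumrMnl -mulr_suml E1 sumr_const card_mx mul1n.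
  rewrite -[X in _ + X]mulr_natl natrX Qn.
  by field; rewrite gt_eqF.
rewrite (eq_bigr _ inner) -mulr_sumr ler_pM2l // sumrB sumr_const -natr_sum.
have := sum_pairs_subspaces S k hk; rewrite -(ler_nat R) !(natrD, natrM, natrX).
rewrite -[\sum_(W in _) _]/(\sum_(W in _) P W)%N.
rewrite -/s -/G Qn -[X in _ - X]mulr_natr -/G; set T : R := _%:R => hT.
rewrite lerBlDr -(ler_pM2r (mulr_gt0 Qk0 r0)); apply: le_trans hT _.
by rewrite le_eqVlt; apply/orP; left; apply/eqP; field; rewrite gt_eqF.
Qed.

Lemma translate_mem_eq v w W : w \in translate v W -> translate w W = translate v W.
Proof.
rewrite mem_translate => wvW; apply/setP => x; rewrite !mem_translate.
have -> : x - v = (x - w) + (w - v) by rewrite addrA addrNK.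
by rewrite (rpredDr _ wvW).
Qed.

(** A [k]-flat [A] has direction [W] for some [W], and it is [translate v W] for
    each of its [q ^ k] points [v]. *)
Lemma card_parametrizations k (L : {set {set V}}) :
  (forall A, A \in L -> is_flat k A) ->
  (#|L| * q ^ k <= \sum_(W in subspaces k) \sum_(v | translate v W \in L) 1)%N.
Proof.
move=> flL; rewrite pair_big_dep /=.
rewrite (partition_big (fun p : {vspace V} * V => translate p.2 p.1) (mem L)) /=; last first.
  by move=> p /andP[].
rewrite -sum_nat_const; apply: leq_sum => A AL.
have /existsP[W /andP[/eqP dW /existsP[v0 /eqP defA]]] := flL A AL.
rewrite sum1_card -dW -(card_translate v0) -defA.
rewrite -(card_imset (mem A) (_ : injective (pair W))); last by move=> v w [].
apply/subset_leq_card/subsetP => p /imsetP[v vA ->].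
rewrite unfold_in /= mem_subspaces dW eqxx /=.
have -> : translate v W = A by rewrite defA; apply: translate_mem_eq; rewrite -defA.
by rewrite AL eqxx.
Qed.

(** Only the parametrized flats in [L] are kept in the second moment. *)
Lemma rich_flats S (L : {set {set V}}) k m : (0 < k <= n)%N ->
  (forall A, A \in L -> is_flat k A /\ (m <= #|A :&: S|)%N) ->
  #|S|%:R / q%:R ^+ (n - k) <= m%:R :> R ->
  #|L|%:R * (m%:R - #|S|%:R / q%:R ^+ (n - k)) ^+ 2 <= #|S|%:R * #|subspaces k|%:R :> R.
Proof.
move=> hk hL hm; set t := _ / _ in hm *.
have Q0 : 0 < q%:R :> R by rewrite ltr0n (ltn_trans _ (finNzRing_gt1 F)).
have Qk0 : 0 < q%:R ^+ k :> R by rewrite exprn_gt0.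
rewrite -(ler_pM2l Qk0); apply: le_trans (second_moment_flats S k hk).
rewrite mulrA [_ * #|L|%:R]mulrC.
have := card_parametrizations k L (fun A AL => (hL A AL).1).
rewrite -(ler_nat R) natrM natrX => /(ler_wpM2r (sqr_ge0 (m%:R - t)))/le_trans; apply.
rewrite natr_sum mulr_suml; apply: ler_sum => W _.
rewrite natr_sum mulr_suml big_mkcond /=; apply: ler_sum => v _.
case: ifP => [vWL | _]; last exact: sqr_ge0.
have [_ le_m] := hL _ vWL; rewrite mul1r -/t ler_sqr ?nnegrE ?subr_ge0 //.
  by rewrite lerD2r ler_nat setIC.
by rewrite (le_trans hm) // ler_nat setIC.
Qed.

End SecondMoment.

(** * The lower bound *)

(** A flat determines its direction. *)
Lemma translate_inj (F : finFieldType) (n : nat) (v v' : 'rV[F]_n) W W' :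
  translate v W = translate v' W' -> W = W'.
Proof.
suff sub u u' (U U' : {vspace 'rV[F]_n}) : translate u U = translate u' U' -> (U <= U')%VS.
  by move=> E; apply/eqP; rewrite eqEsubv (sub _ _ _ _ E) (sub _ _ _ _ (esym E)).
move=> E; apply/subvP => w wU.
have := mem_translate _ _ u U u; rewrite subrr mem0v E mem_translate => uU'.
have := mem_translate _ _ u U (w + u); rewrite addrK wU E mem_translate => wuU'.
by have := rpredB wuU' uU'; rewrite opprB addrA addrNK addrK.
Qed.

Lemma deviation_bound (R : rcfType) (m r s : R) : 0 < m -> 0 < r ->
  (s / r <= m -> (m - s / r) ^+ 2 <= s) -> m - s / r <= Num.sqrt (r / m) * m.
Proof.
move=> m0 r0 dev; have a0 := sqrtr_ge0 (r / m).
have [le_m | lt_m] := leP (s / r) m; last first.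
  by apply: (@le_trans _ _ 0); [rewrite subr_le0 ltW | rewrite mulr_ge0 // ltW].
rewrite -ler_sqr ?nnegrE ?subr_ge0 //; last by rewrite mulr_ge0 // ltW.
apply: le_trans (dev le_m) _; rewrite exprMn sqr_sqrtr; last first.
  by rewrite divr_ge0 // ltW.
have -> : r / m * m ^+ 2 = m * r by field; rewrite gt_eqF.
by rewrite -ler_pdivrMr.
Qed.

Theorem theorem3 (R : rcfType) (q : nat) (F : finFieldType) (hq : #|F| = q)
    (n k m : nat) (hnk : (n < 2 * k)%N) (hkn : (k < n)%N)
    (hm1 : (1 <= m)%N) (hmq : (m <= q ^ k)%N) :
  (forall (S : {set 'rV[F]_n}) (L : {set {set 'rV[F]_n}}),
      (forall A : {set 'rV[F]_n}, A \in L ->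
         is_flat k A /\ (m <= #|A :&: S|)%N) ->
      #|L|%:R = qbinom (q%:R : R) n k ->
      (1 - (q%:R : R) ^ (n%:Z - (2 * k)%N%:Z)
         - Num.sqrt ((q%:R : R) ^+ (n - k) * (m%:R)^-1))
        * m%:R * q%:R ^+ (n - k) <= #|S|%:R)
  /\ (1 - (q%:R : R) ^ (n%:Z - (2 * k)%N%:Z)
        - Num.sqrt ((q%:R : R) ^+ (n - k) * (m%:R)^-1))
       * m%:R * q%:R ^+ (n - k) <= (furstenberg_min F n k m)%:R.
Proof.
have q1 : (1 < q)%N by rewrite -hq finNzRing_gt1.
have hk : (0 < k <= n)%N by rewrite (ltnW hkn) andbT; lia.
have Gq : #|subspaces_over k ([::] : seq 'rV[F]_n)|%:R = qbinom (q%:R : R) n k.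
  apply: (qbinomP _ q q1 _ n k (ltnW hkn)).
  by have := @card_subspaces_over F n k [::] (nil_free _) (leq0n _); rewrite hq subn0.
have G0 := card_subspaces_gt0 F n k (ltnW hkn).
have part1 (S : {set 'rV[F]_n}) (L : {set {set 'rV[F]_n}}) :
    (forall A, A \in L -> is_flat k A /\ (m <= #|A :&: S|)%N) ->
    #|L| = #|subspaces_over k ([::] : seq 'rV[F]_n)| ->
    (1 - (q%:R : R) ^ (n%:Z - (2 * k)%N%:Z)
       - Num.sqrt ((q%:R : R) ^+ (n - k) * (m%:R)^-1)) * m%:R * q%:R ^+ (n - k) <= #|S|%:R.
  move=> hL cardL.
  have := @rich_flats R F n S L k m hk hL; rewrite hq cardL.
  have Q0 : 0 < q%:R :> R by rewrite ltr0n ltnW.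
  set r : R := _ ^+ (n - k); have r0 : 0 < r by rewrite exprn_gt0.
  set s : R := #|S|%:R; set z := _ ^ _; have z0 : 0 <= z by rewrite exprz_ge0 // ltW.
  have M0 : 0 < m%:R :> R by rewrite ltr0n.
  move=> rich; have := deviation_bound R m%:R r s M0 r0.
  set M : R := m%:R in M0 rich *; set a := Num.sqrt _ => key.
  have {}key : M - s / r <= a * M.
    by apply: key => /rich; rewrite mulrC ler_pM2r ?ltr0n.
  (* The nonnegative term [z] is dropped. *)
  rewrite -ler_pdivlMr //; apply: le_trans (_ : (1 - a) * M <= _); last by lra.
  by apply: ler_wpM2r; [exact: ltW | lra].
split=> [S L hL cardL | ].
  by apply: (part1 S L hL); apply/eqP; rewrite -(eqr_nat R) cardL Gq.
have [[S [/forallP furS <-]] _] := @furstenberg_minP F n k m ltac:(by rewrite hq).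
have /fin_all_exists[f fP] : forall W : {vspace 'rV[F]_n}, exists v,
    (\dim W == k) ==> (m <= #|S :&: translate v W|)%N.
  move=> W; case: eqP => dW; last by exists 0.
  by have := furS W; rewrite dW eqxx => /existsP.
apply: (part1 S [set translate (f W) W | W in subspaces_over k [::]]).
  move=> A /imsetP[W]; rewrite mem_subspaces => dW ->; split.
    by apply/existsP; exists W; rewrite dW; apply/existsP; exists (f W).
  by have := fP W; rewrite dW setIC.
by rewrite card_imset // => W W' /translate_inj.
Qed.
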